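(* Let $(L,0,1,\oplus)$ be an effect algebra for which the tensor product $L\otimes L$ (in the category of effect algebras) exists, and suppose $L$ has the cloning property. Suppose there exists a finite family $\{p_1,p_2,\ldots,p_N\}\subset L$ such that, for every $n$, the interval $[0,p_n]$ is a linearly ordered ideal of $L$, and such that the orthogonal sum $\bigoplus_{n=1}^N p_n$ is defined and equals $1$. Then $L$ admits hidden variables.
   Context: **Effect algebra.** A quadruple $(L,0,1,\oplus)$ where $L$ is a set with two special elements $0,1$ and $\oplus$ is a partially defined binary operation (write $p\perp q$ when $p\oplus q$ is defined) such that for all $p,q,r\in L$: (i) if $p\perp q$ then $q\perp p$ and $p\oplus q=q\oplus p$; (ii) if $q\perp r$ and $p\perp(q\oplus r)$, then $p\perp q$, $(p\oplus q)\perp r$ and $p\oplus(q\oplus r)=(p\oplus q)\oplus r$; (iii) for every $p\in L$ there is a unique $q\in L$ with $p\perp q$ and $p\oplus q=1$; this $q$ is denoted $p'$; (iv') if $p\perp 1$ then $p=0$. **Order, intervals, ideals.** $p\le q$ means there is $r\in L$ with $p\perp r$ and $q=p\oplus r$. This is a partial order with least element $0$ and greatest element $1$. For $p\in L$, $[0,p]=\{x\in L:0\le x\le p\}$. An ideal of $L$ is a nonempty subset $I\subset L$ such that $x\le y\in I$ implies $x\in I$, and $x,y\in I$ with $x\perp y$ implies $x\oplus y\in I$. ''Linearly ordered'' means that any two elements are comparable for $\le$. **Morphism.** A map $\phi:L_1\to L_2$ between effect algebras such that $p\perp q$ implies $\phi(p)\perp\phi(q)$ and $\phi(p\oplus q)=\phi(p)\oplus\phi(q)$,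 and $\phi(1)=1$. **Bimorphism.** For effect algebras $P,Q,K$, a map $\beta:P\times Q\to K$ such that: if $a\perp b$ in $P$ and $q\in Q$, then $\beta(a,q)\perp\beta(b,q)$ and $\beta(a\oplus b,q)=\beta(a,q)\oplus\beta(b,q)$; if $c\perp d$ in $Q$ and $p\in P$, then $\beta(p,c)\perp\beta(p,d)$ and $\beta(p,c\oplus d)=\beta(p,c)\oplus\beta(p,d)$; and $\beta(1,1)=1$. **Tensor product.** A tensor product of effect algebras $P,Q$ is a pair $(T,\tau)$ with $T$ an effect algebra and $\tau:P\times Q\to T$ a bimorphism such that: (i) for every effect algebra $K$ and every bimorphism $\beta:P\times Q\to K$ there is a morphism $\alpha:T\to K$ with $\beta=\alpha\circ\tau$; (ii) every element of $T$ is a finite orthogonal sum (a defined iterated $\oplus$) of elements of the form $\tau(p,q)$. One writes $P\otimes Q$ for $T$ and $p\otimes q$ for $\tau(p,q)$. **Cloning property.** A cloning map on $L$ is a morphism $\phi:L\otimes L\to L$ with $\phi(p\otimes 1)=\phi(1\otimes p)=p$ for all $p\in L$. $L$ has the cloning property if a cloning map $\phi:L\otimes L\to L$ exists. **State.** A state on an effect algebra $L$ is a map $\mu:L\to\mathbb{R}$ with $\mu(p)\ge 0$ for all $p$, $\mu(1)=1$, and $\mu(p\oplus q)=\mu(p)+\mu(q)$ whenever $p\perp q$. **MV-algebra.** A set $M$ with two special elements $0,1$, a binary operation $+$ and a unary operation $'$ such that for all $a,b,c\in M$: $a+b=b+a$; $(a+b)+c=a+(b+c)$; $a+a'=1$;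 $a+0=a$; $(a')'=a$; $0'=1$; $a+1=1$; $(a'+b)'+b=(a+b')'+a$. It is partially ordered by $a\le b$ iff $a'+b=1$. Setting $a\oplus b:=a+b$, defined only when $a\le b'$, makes $(M,0,1,\oplus)$ an effect algebra; states on $M$ are the states on this effect algebra. **Hidden variables.** An effect algebra $L$ admits hidden variables if there exists an MV-algebra $M$ such that: (i) there exists a morphism $h:L\to M$ (a morphism of effect algebras, $M$ carrying its associated effect algebra structure; in particular $h(p\oplus q)=h(p)+h(q)$ whenever $p\perp q$); and (ii) for every state $\omega$ on $L$ there exists a state $\overline{\omega}$ on $M$ such that $\overline{\omega}(h(q))=\omega(q)$ for every $q\in L$. *)

(* Defs.v *)
From mathcomp Require Import all_boot all_order all_algebra.
From mathcomp Require Import classical_sets reals.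

Set Implicit Arguments.
Unset Strict Implicit.
Unset Printing Implicit Defensive.

Import GRing.Theory Num.Theory.
Local Open Scope classical_set_scope.

(* The partial operation is encoded as a total function [oplus] together with
   its domain of definition [perp]: the value [oplus p q] is meaningful only
   when [perp p q] holds, and nothing below depends on it otherwise. *)
Record effectAlgebra := EffectAlgebra {
  ea_sort :> Type;
  ea0 : ea_sort;
  ea1 : ea_sort;
  perp : ea_sort -> ea_sort -> Prop;
  oplus : ea_sort -> ea_sort -> ea_sort;
  oplusC : forall p q, perp p q -> perp q p /\ oplus p q = oplus q p;
  oplusA : forall p q r, perp q r -> perp p (oplus q r) ->
    [/\ perp p q, perp (oplus p q) r
      & oplus p (oplus q r) = oplus (oplus p q) r];
  ea_orthosupplement : forall p, exists! q, perp p q /\ oplus p q = ea1;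
  perp1_eq0 : forall p, perp p ea1 -> p = ea0
}.

Arguments ea0 {e}.
Arguments ea1 {e}.
Arguments perp {e}.
Arguments oplus {e}.

Section EffectAlgebraNotions.
Variable L : effectAlgebra.

Definition ea_le (p q : L) : Prop := exists r : L, perp p r /\ q = oplus p r.

Definition ea_interval0 (p : L) : set L :=
  [set x | ea_le ea0 x /\ ea_le x p].

Definition ea_ideal (I : set L) : Prop :=
  [/\ I !=set0,
      forall x y, ea_le x y -> I y -> I x
    & forall x y, I x -> I y -> perp x y -> I (oplus x y)].

Definition linearly_ordered (I : set L) : Prop :=
  forall x y, I x -> I y -> ea_le x y \/ ea_le y x.

(* [osummable s] says that the orthogonal sum of [s] is defined, and [osum s]
   is then its value; the sum is right-nested and ends with [ea0], which is
   orthogonal to every element and neutral. *)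
Definition osum (s : seq L) : L := foldr oplus ea0 s.

Fixpoint osummable (s : seq L) : Prop :=
  if s is x :: s' then osummable s' /\ perp x (osum s') else True.

Definition ea_state (R : realType) (mu : L -> R) : Prop :=
  [/\ forall p, (0 <= mu p)%R,
      mu ea1 = 1%R
    & forall p q, perp p q -> mu (oplus p q) = (mu p + mu q)%R].

End EffectAlgebraNotions.

Definition ea_morphism (L1 L2 : effectAlgebra) (phi : L1 -> L2) : Prop :=
  (forall p q, perp p q ->
     perp (phi p) (phi q) /\ phi (oplus p q) = oplus (phi p) (phi q))
  /\ phi ea1 = ea1.

Definition ea_bimorphism (P Q K : effectAlgebra) (beta : P -> Q -> K) : Prop :=
  [/\ forall a b q, perp a b ->
        perp (beta a q) (beta b q)
        /\ beta (oplus a b) q = oplus (beta a q) (beta b q),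
      forall p c d, perp c d ->
        perp (beta p c) (beta p d)
        /\ beta p (oplus c d) = oplus (beta p c) (beta p d)
    & beta ea1 ea1 = ea1].

Record tensorProduct (P Q : effectAlgebra) := TensorProduct {
  tensor_ea :> effectAlgebra;
  tensor : P -> Q -> tensor_ea;
  tensor_bimorphism : ea_bimorphism tensor;
  tensor_universal : forall (K : effectAlgebra) (beta : P -> Q -> K),
    ea_bimorphism beta ->
    exists alpha : tensor_ea -> K,
      ea_morphism alpha /\ forall p q, beta p q = alpha (tensor p q);
  tensor_generated : forall t : tensor_ea, exists s : seq (P * Q),
    osummable [seq tensor pq.1 pq.2 | pq <- s]
    /\ t = osum [seq tensor pq.1 pq.2 | pq <- s]
}.

Definition cloning_map (L : effectAlgebra) (LL : tensorProduct L L)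
    (phi : LL -> L) : Prop :=
  ea_morphism phi
  /\ forall p : L, phi (tensor LL p ea1) = p /\ phi (tensor LL ea1 p) = p.

Definition cloning_property (L : effectAlgebra) (LL : tensorProduct L L) : Prop :=
  exists phi : LL -> L, cloning_map phi.

Record mvAlgebra := MVAlgebra {
  mv_sort :> Type;
  mv0 : mv_sort;
  mv1 : mv_sort;
  mv_add : mv_sort -> mv_sort -> mv_sort;
  mv_neg : mv_sort -> mv_sort;
  mv_addC : forall a b, mv_add a b = mv_add b a;
  mv_addA : forall a b c, mv_add (mv_add a b) c = mv_add a (mv_add b c);
  mv_addN : forall a, mv_add a (mv_neg a) = mv1;
  mv_addr0 : forall a, mv_add a mv0 = a;
  mv_negK : forall a, mv_neg (mv_neg a) = a;
  mv_neg0 : mv_neg mv0 = mv1;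
  mv_addr1 : forall a, mv_add a mv1 = mv1;
  mv_luk : forall a b, mv_add (mv_neg (mv_add (mv_neg a) b)) b
                     = mv_add (mv_neg (mv_add a (mv_neg b))) a
}.

Arguments mv0 {m}.
Arguments mv1 {m}.
Arguments mv_add {m}.
Arguments mv_neg {m}.

Section MVEffectAlgebra.
Variable M : mvAlgebra.
Implicit Types a b c p q r : M.

Definition mv_le a b : Prop := mv_add (mv_neg a) b = mv1.

Definition mv_perp a b : Prop := mv_le a (mv_neg b).

Lemma mv_neg1 : mv_neg mv1 = mv0 :> M.
Proof. by rewrite -mv_neg0 mv_negK. Qed.

Lemma mv_add0r a : mv_add mv0 a = a.
Proof. by rewrite mv_addC mv_addr0. Qed.

Lemma mv_leP a b : mv_le a b <-> exists c, b = mv_add a c.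
Proof.
split=> [ab | [c ->]].
  exists (mv_neg (mv_add a (mv_neg b))).
  by rewrite mv_addC -mv_luk ab mv_neg1 mv_add0r.
rewrite /mv_le -mv_addA [mv_add (mv_neg a) a]mv_addC mv_addN.
by rewrite mv_addC mv_addr1.
Qed.

Lemma mv_le_anti a b : mv_le a b -> mv_le b a -> a = b.
Proof.
move=> ab ba; have := mv_luk a b.
by rewrite ab [mv_add a _]mv_addC ba mv_neg1 !mv_add0r.
Qed.

Lemma mv_perpC p q : mv_perp p q -> mv_perp q p /\ mv_add p q = mv_add q p.
Proof. by move=> pq; split; rewrite 1?mv_addC // /mv_perp /mv_le mv_addC. Qed.

Lemma mv_perpA p q r : mv_perp q r -> mv_perp p (mv_add q r) ->
  [/\ mv_perp p q, mv_perp (mv_add p q) r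
    & mv_add p (mv_add q r) = mv_add (mv_add p q) r].
Proof.
move=> qr /mv_leP[c pqr].
have rE : mv_neg r = mv_add (mv_neg (mv_add q r)) q.
  have := mv_luk q (mv_neg r); rewrite mv_negK => <-.
  by rewrite qr mv_neg1 mv_add0r.
have : mv_le (mv_neg (mv_add q r)) (mv_neg q).
  rewrite /mv_le mv_negK mv_addC -mv_addA [mv_add (mv_neg q) q]mv_addC mv_addN.
  by rewrite mv_addC mv_addr1.
move=> /mv_leP[d qE]; split.
- by apply/mv_leP; exists (mv_add c d); rewrite qE pqr mv_addA.
- apply/mv_leP; exists c; rewrite rE pqr !mv_addA; congr mv_add.
  exact: mv_addC.
- by rewrite mv_addA.
Qed.

Lemma mv_orthosupplement p : exists! q, mv_perp p q /\ mv_add p q = mv1.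
Proof.
exists (mv_neg p); split.
  by split; [rewrite /mv_perp /mv_le mv_negK mv_addC mv_addN | exact: mv_addN].
move=> q [pq pq1]; apply: mv_le_anti; first by rewrite /mv_le mv_negK.
by rewrite /mv_le mv_addC.
Qed.

Lemma mv_perp1_eq0 p : mv_perp p mv1 -> p = mv0.
Proof.
rewrite /mv_perp /mv_le mv_neg1 mv_addr0 => p1.
by rewrite -[p]mv_negK p1 mv_neg1.
Qed.

Definition mv_effectAlgebra : effectAlgebra :=
  EffectAlgebra mv_perpC mv_perpA mv_orthosupplement mv_perp1_eq0.

End MVEffectAlgebra.

Definition admits_hidden_variables (R : realType) (L : effectAlgebra) : Prop :=
  exists (M : mvAlgebra) (h : L -> mv_effectAlgebra M),
    ea_morphism h
    /\ forall omega : L -> R, ea_state omega ->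
       exists omegabar : mv_effectAlgebra M -> R,
         ea_state omegabar /\ forall q : L, omegabar (h q) = omega q.

(* Main.v *)
Require Import Defs.
From mathcomp Require Import all_boot all_order all_algebra.
From mathcomp Require Import boolp classical_sets reals.

(** The cloning map turns the tensor product into a biadditive product on [L]
  with unit [ea1], so [x] is the orthogonal sum of the [x * p n], where
  [x * p n <= p n]. Each [[0, p n]] is a linearly ordered effect algebra,
  hence an MV-algebra for the truncated sum. The product of these MV-algebras
  serves as [M], with [h x n = x * p n], and a state [omega] extends to
  [omegabar f = \sum_n omega (f n)]. *)

Set Implicit Arguments.
Unset Strict Implicit.
Unset Printing Implicit Defensive.

Import GRing.Theory Num.Theory.

(** * Elementary arithmetic of effect algebras: complements, cancellation, order *)

Section EffectAlgebraTheory.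
Variable L : effectAlgebra.
Implicit Types a b c d x y z : L.

Lemma perp_sym a b : perp a b -> perp b a.
Proof. by case/oplusC. Qed.

Lemma oplus_sym a b : perp a b -> oplus a b = oplus b a.
Proof. by case/oplusC. Qed.

(** The mirror image of the associativity axiom [oplusA], obtained by commuting every sum. *)
Lemma oplusAl a b c : perp a b -> perp (oplus a b) c ->
  [/\ perp b c, perp a (oplus b c)
    & oplus a (oplus b c) = oplus (oplus a b) c].
Proof.
move=> ab abc; have [ba abE] := oplusC ab.
have [cab abcE] := oplusC abc.
rewrite abE in cab; have [cb cba e] := oplusA ba cab.
have [bc cbE] := oplusC cb; have [abc' cbaE] := oplusC cba.
by split=> //; rewrite -cbE // abcE abE e cbaE.
Qed.

Definition ea_neg a : L := sval (cid (ea_orthosupplement a)).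

Lemma perp_neg a : perp a (ea_neg a).
Proof. by rewrite /ea_neg; case: (cid _) => /= q [[]]. Qed.

Lemma oplus_neg a : oplus a (ea_neg a) = ea1.
Proof. by rewrite /ea_neg; case: (cid _) => /= q [[]]. Qed.

Lemma ea_neg_unique a b : perp a b -> oplus a b = ea1 -> ea_neg a = b.
Proof. by move=> ab e; rewrite /ea_neg; case: (cid _) => /= q [_]; exact. Qed.

Lemma ea_negK a : ea_neg (ea_neg a) = a.
Proof.
apply: ea_neg_unique; first exact/perp_sym/perp_neg.
by rewrite -(oplus_sym (perp_neg a)) oplus_neg.
Qed.

Lemma perp10 : perp ea1 (ea0 : L).
Proof.
by have := perp_neg ea1; rewrite (perp1_eq0 (perp_sym (perp_neg ea1))).
Qed.

Lemma oplus10 : oplus ea1 ea0 = ea1 :> L.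
Proof.
by rewrite -{2}(oplus_neg ea1) (perp1_eq0 (perp_sym (perp_neg ea1))).
Qed.

(** [ea0] is orthogonal to [ea1], written as the sum of [a] and its complement, and associativity
    passes orthogonality down to [a]. *)
Lemma perp_ea0 a : perp a ea0.
Proof.
have := perp10; rewrite -(oplus_neg a) => /perp_sym h.
by have [/perp_sym] := oplusA (perp_neg a) h.
Qed.

(** Both [a] and [oplus ea0 a] are orthosupplements of [ea_neg a]. *)
Lemma oplus_ea0 a : oplus a ea0 = a.
Proof.
have := perp10; rewrite -(oplus_neg a) => /perp_sym h.
have [oa oan e] := oplusA (perp_neg a) h.
rewrite -(oplus_sym oa) -[RHS]ea_negK; apply/esym/ea_neg_unique.
  exact: perp_sym.
by rewrite -(oplus_sym oan) -e oplus_neg -(oplus_sym perp10) oplus10.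
Qed.

(** With [d] the complement of the common sum, [b] and [c] are both the orthosupplement of
    [oplus d a]. *)
Lemma oplus_cancel a b c :
  perp a b -> perp a c -> oplus a b = oplus a c -> b = c.
Proof.
move=> ab ac e; pose d := ea_neg (oplus a b).
have dab : perp d (oplus a b) by exact/perp_sym/perp_neg.
have d1 : oplus d (oplus a b) = ea1.
  by rewrite -(oplus_sym (perp_neg _)) oplus_neg.
have [_ db e1] := oplusA ab dab.
rewrite e in dab d1; have [_ dc e2] := oplusA ac dab.
by rewrite -(ea_neg_unique db) ?(ea_neg_unique dc) // -?e1 -?e2 // e.
Qed.

Lemma oplus_eq0 a b : perp a b -> oplus a b = ea0 -> a = ea0.
Proof.
move=> ab e; have h : perp ea1 (oplus a b) by rewrite e; exact: perp10.
by have [/perp_sym/perp1_eq0] := oplusA ab h.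
Qed.

Lemma ea_le0 a : ea_le ea0 a.
Proof.
by exists a; rewrite -(oplus_sym (perp_ea0 a)) oplus_ea0;
  split=> //; exact/perp_sym/perp_ea0.
Qed.

Lemma ea_lexx a : ea_le a a.
Proof. by exists ea0; rewrite oplus_ea0; split=> //; exact: perp_ea0. Qed.

Lemma ea_le_oplus a b : perp a b -> ea_le a (oplus a b).
Proof. by exists b. Qed.

Lemma ea_le_oplusr a b : perp a b -> ea_le b (oplus a b).
Proof. by move=> ab; exists a; case/oplusC: ab. Qed.

Lemma ea_le_trans b a c : ea_le a b -> ea_le b c -> ea_le a c.
Proof.
move=> [x [ax ->]] [y [axy ->]].
by have [xy a_xy e] := oplusAl ax axy; exists (oplus x y).
Qed.

Lemma perp_le a b c : ea_le a b -> perp b c -> perp a c.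
Proof.
move=> [x [ax ->]] axc; rewrite (oplus_sym ax) in axc.
by have [] := oplusAl (perp_sym ax) axc.
Qed.

Lemma ea_le_neg_perp a b : ea_le a (ea_neg b) -> perp a b.
Proof. by move=> ab; exact: perp_le ab (perp_sym (perp_neg b)). Qed.

(** The difference between [ea_neg b] and [a] is the complement of [oplus a b]. *)
Lemma perp_le_neg a b : perp a b -> ea_le a (ea_neg b).
Proof.
move=> ab; have [ba e] := oplusC ab.
have h := perp_neg (oplus a b); rewrite {1}e in h.
have [ac bac acE] := oplusAl ba h.
exists (ea_neg (oplus a b)); split=> //; apply: ea_neg_unique => //.
by rewrite acE -e oplus_neg.
Qed.

Lemma osum_state (R : realType) (omega : L -> R) (s : seq L) :
  ea_state omega -> osummable s ->
  omega (osum s) = (\sum_(x <- s) omega x)%R.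
Proof.
move=> [_ omega1 omegaD]; elim: s => [_|x s IHs [ss xs]].
  (* Additivity on the sum of [ea1] and [ea0] forces [omega ea0 = 0]. *)
  rewrite big_nil /=; apply: (@addrI _ (omega ea1)).
  by rewrite -omegaD ?oplus10 ?addr0 //; exact: perp10.
by rewrite big_cons /= omegaD // IHs.
Qed.

End EffectAlgebraTheory.

(** * The interval below [p] as an effect algebra with unit [p] *)

Section Interval.
Variables (L : effectAlgebra) (p : L).

Let I := {x : L | ea_le x p}.

Lemma interval_inj (x y : I) : sval x = sval y -> x = y.
Proof.
case: x y => x xp [y yp] /= e; subst y.
by congr exist; exact: Prop_irrelevance.
Qed.

Definition interval_perp (x y : I) : Prop :=
  perp (sval x) (sval y) /\ ea_le (oplus (sval x) (sval y)) p.

(** Totalised with the arbitrary default [x]; only the bound by [p] is tested, since it is what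
    membership of the sum in the interval requires. *)
Definition interval_oplus (x y : I) : I :=
  if pselect (ea_le (oplus (sval x) (sval y)) p) is left h
  then exist (fun z => ea_le z p) _ h else x.

Lemma interval_oplusE x y : interval_perp x y ->
  sval (interval_oplus x y) = oplus (sval x) (sval y).
Proof. by move=> [_ xy]; rewrite /interval_oplus; case: pselect. Qed.

Definition interval0 : I := exist (fun z => ea_le z p) ea0 (ea_le0 p).
Definition interval1 : I := exist (fun z => ea_le z p) p (ea_lexx p).

Lemma interval_oplusC x y : interval_perp x y ->
  interval_perp y x /\ interval_oplus x y = interval_oplus y x.
Proof.
move=> pxy; have [xy xyp] := pxy; have [yx e] := oplusC xy.
have pyx : interval_perp y x by split=> //; rewrite -e.
by split=> //; apply: interval_inj; rewrite !interval_oplusE.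
Qed.

Lemma interval_oplusA x y z :
  interval_perp y z -> interval_perp x (interval_oplus y z) ->
  [/\ interval_perp x y, interval_perp (interval_oplus x y) z
    & interval_oplus x (interval_oplus y z)
      = interval_oplus (interval_oplus x y) z].
Proof.
move=> pyz pxyz; have [] := pxyz; rewrite interval_oplusE // => xyz xyzp.
have [xy xy_z e] := oplusA (proj1 pyz) xyz.
have pxy : interval_perp x y.
  by split=> //; apply: ea_le_trans (ea_le_oplus xy_z) _; rewrite -e.
have pxy_z : interval_perp (interval_oplus x y) z.
  by split; rewrite interval_oplusE // -e.
by split=> //; apply: interval_inj; rewrite !interval_oplusE.
Qed.

Lemma interval_orthosupplement x :
  exists! y, interval_perp x y /\ interval_oplus x y = interval1.
Proof.
case: (svalP x) => r [xr pE].
have rp : ea_le r p by rewrite pE; exact: ea_le_oplusr.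
have pxr : interval_perp x (exist (fun z => ea_le z p) r rp).
  by rewrite /interval_perp /= -pE; split=> //; exact: ea_lexx.
exists (exist (fun z => ea_le z p) r rp); split.
  by split=> //; apply: interval_inj; rewrite interval_oplusE.
move=> y [pxy /(congr1 sval)]; rewrite interval_oplusE //= => e.
by apply: interval_inj; apply: (oplus_cancel xr (proj1 pxy)); rewrite e -pE.
Qed.

Lemma interval_perp1_eq0 x : interval_perp x interval1 -> x = interval0.
Proof.
move=> [/= xp [r [xpr e]]]; apply: interval_inj => /=.
(* Now [p] is the sum of [p], [x] and [r], so cancelling [p] leaves [oplus x r = ea0]. *)
have [px xpE] := oplusC xp; rewrite xpE in xpr e.
have [xr p_xr e'] := oplusAl px xpr.
apply: (oplus_eq0 xr); apply: (oplus_cancel p_xr (perp_ea0 p)).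
by rewrite e' -e oplus_ea0.
Qed.

Definition intervalAlgebra : effectAlgebra :=
  EffectAlgebra interval_oplusC interval_oplusA
    interval_orthosupplement interval_perp1_eq0.

(** The order of [L] restricts to the order of the interval: a difference of two elements below [p]
    is itself below [p]. *)
Lemma interval_linear : linearly_ordered (ea_interval0 p) ->
  forall x y : intervalAlgebra, ea_le x y \/ ea_le y x.
Proof.
have lift (x y : I) : ea_le (sval x) (sval y) ->
    @ea_le intervalAlgebra x y.
  move=> [r [xr yE]]; have yp : ea_le (sval y) p := svalP y.
  have rp : ea_le r p.
    by apply: (ea_le_trans _ yp); rewrite yE; exact: ea_le_oplusr.
  have pxr : interval_perp x (exist (fun z => ea_le z p) r rp).
    by split=> //=; rewrite -yE.
  exists (exist (fun z => ea_le z p) r rp); split=> //.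
  by apply: interval_inj; rewrite interval_oplusE.
move=> lin x y; have mem (z : I) : ea_interval0 p (sval z).
  by split; [exact: ea_le0 | exact: (svalP z)].
by case: (lin _ _ (mem x) (mem y)) => /lift; [left|right].
Qed.

End Interval.

(** * A linearly ordered effect algebra is an MV-algebra *)

Section LinearMV.
Variable E : effectAlgebra.
Hypothesis E_linear : forall x y : E, ea_le x y \/ ea_le y x.
Implicit Types a b c : E.

Definition trunc_add a b : E := if pselect (perp a b) then oplus a b else ea1.

Lemma trunc_add_perp a b : perp a b -> trunc_add a b = oplus a b.
Proof. by rewrite /trunc_add; case: pselect. Qed.

Lemma trunc_add_nperp a b : ~ perp a b -> trunc_add a b = ea1.
Proof. by rewrite /trunc_add; case: pselect. Qed.

Lemma trunc_addC a b : trunc_add a b = trunc_add b a.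
Proof.
have [ab|nab] := pselect (perp a b).
  by have [ba e] := oplusC ab; rewrite !trunc_add_perp.
by rewrite !trunc_add_nperp // => /perp_sym.
Qed.

Lemma trunc_add0 a : trunc_add a ea0 = a.
Proof. by rewrite trunc_add_perp ?oplus_ea0 //; exact: perp_ea0. Qed.

Lemma trunc_add1 a : trunc_add a ea1 = ea1.
Proof.
have [a1|na1] := pselect (perp a ea1); last exact: trunc_add_nperp.
by rewrite (perp1_eq0 a1) trunc_addC trunc_add0.
Qed.

(** If the triple sum is defined, this is associativity in [E]; otherwise both sides are truncated
    to [ea1]. *)
Lemma trunc_addA a b c :
  trunc_add (trunc_add a b) c = trunc_add a (trunc_add b c).
Proof.
have [[ab abc]|nl] := pselect (perp a b /\ perp (oplus a b) c).
  have [bc a_bc e] := oplusAl ab abc.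
  by rewrite [trunc_add a b]trunc_add_perp // [trunc_add b c]trunc_add_perp //
    !trunc_add_perp.
have -> : trunc_add (trunc_add a b) c = ea1.
  have [ab|nab] := pselect (perp a b).
    by rewrite [trunc_add a b]trunc_add_perp // trunc_add_nperp; auto.
  by rewrite [trunc_add a b]trunc_add_nperp // trunc_addC trunc_add1.
have [bc|nbc] := pselect (perp b c).
  rewrite [trunc_add b c]trunc_add_perp // trunc_add_nperp // => abc.
  by apply: nl; have [] := oplusA bc abc.
by rewrite [trunc_add b c]trunc_add_nperp // trunc_add1.
Qed.

Lemma trunc_addN a : trunc_add a (ea_neg a) = ea1.
Proof. by rewrite trunc_add_perp ?oplus_neg //; exact: perp_neg. Qed.

Lemma ea_neg0 : ea_neg ea0 = ea1 :> E.
Proof.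
apply: ea_neg_unique; first exact/perp_sym/perp_ea0.
by rewrite -(oplus_sym (perp_ea0 _)) oplus_ea0.
Qed.

Lemma ea_neg1 : ea_neg ea1 = ea0 :> E.
Proof. by rewrite -ea_neg0 ea_negK. Qed.

Lemma trunc_add_neg_le a b : ea_le b a -> trunc_add a (ea_neg b) = ea1.
Proof.
move=> [c [bc ->]].
have [h|/trunc_add_nperp//] := pselect (perp (oplus b c) (ea_neg b)).
(* Regrouping [b] with its complement shows that [c] is orthogonal to [ea1], hence zero. *)
rewrite (oplus_sym bc) in h *.
have [_ c1 e] := oplusAl (perp_sym bc) h.
rewrite oplus_neg in c1 *; rewrite (perp1_eq0 c1).
by rewrite trunc_add_perp -(oplus_sym (perp_ea0 b)) oplus_ea0 ?oplus_neg //;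
  exact: perp_neg.
Qed.

(** For [a = oplus b c], the complement of [oplus (ea_neg a) b] is [c]. *)
Lemma trunc_join_le a b : ea_le b a ->
  trunc_add (ea_neg (trunc_add (ea_neg a) b)) b = a.
Proof.
move=> [c [bc aE]].
have na : perp (ea_neg a) (oplus b c) by rewrite -aE; exact/perp_sym/perp_neg.
have [nab nabc e] := oplusA bc na.
rewrite [trunc_add (ea_neg a) b]trunc_add_perp // (ea_neg_unique nabc).
  by rewrite trunc_addC trunc_add_perp.
by rewrite -e -aE -(oplus_sym (perp_neg a)) oplus_neg.
Qed.

(** Both sides are the maximum of [a] and [b]. The identity is symmetric in them, so linearity
    reduces it to one comparison. *)
Lemma trunc_luk a b :
  trunc_add (ea_neg (trunc_add (ea_neg a) b)) b
  = trunc_add (ea_neg (trunc_add a (ea_neg b))) a.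
Proof.
have key x y : ea_le y x ->
    trunc_add (ea_neg (trunc_add (ea_neg x) y)) y
    = trunc_add (ea_neg (trunc_add x (ea_neg y))) x.
  move=> yx; rewrite trunc_join_le // trunc_add_neg_le // ea_neg1.
  by rewrite trunc_addC trunc_add0.
case: (E_linear a b) => [|/key//] /key.
by rewrite [trunc_add (ea_neg b) a]trunc_addC [trunc_add b _]trunc_addC.
Qed.

Definition linear_mv : mvAlgebra :=
  MVAlgebra trunc_addC trunc_addA trunc_addN trunc_add0 (@ea_negK E) ea_neg0
    trunc_add1 trunc_luk.

(** Ensures that the effect algebra derived from the MV-algebra has the original orthogonality. *)
Lemma linear_mv_perp a b : @mv_perp linear_mv a b <-> perp a b.
Proof.
rewrite /mv_perp /mv_le /=; split=> [ab1|ab]; last first.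
  by rewrite trunc_addC trunc_add_neg_le //; exact: perp_le_neg.
case: (E_linear a (ea_neg b)) => [|ba]; first exact: ea_le_neg_perp.
(* Here the complements are orthogonal, so their truncated sum is a genuine one; being [ea1], it
   forces [a = ea_neg b]. *)
have nab : perp (ea_neg a) (ea_neg b).
  exact/perp_sym/(perp_le ba)/perp_neg.
rewrite trunc_add_perp // in ab1.
by rewrite -[a]ea_negK (ea_neg_unique nab ab1); exact/perp_sym/perp_neg.
Qed.

End LinearMV.

(** * Products of MV-algebras, with pointwise operations *)

Section ProductMV.
Variables (I : Type) (M : I -> mvAlgebra).

Let T := forall i, M i.
Let add (f g : T) : T := fun i => mv_add (f i) (g i).
Let neg (f : T) : T := fun i => mv_neg (f i).
Let c0 : T := fun=> mv0.
Let c1 : T := fun=> mv1.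

Let addC f g : add f g = add g f.
Proof. by apply: functional_extensionality_dep => i; exact: mv_addC. Qed.

Let addA f g h : add (add f g) h = add f (add g h).
Proof. by apply: functional_extensionality_dep => i; exact: mv_addA. Qed.

Let addN f : add f (neg f) = c1.
Proof. by apply: functional_extensionality_dep => i; exact: mv_addN. Qed.

Let addr0 f : add f c0 = f.
Proof. by apply: functional_extensionality_dep => i; exact: mv_addr0. Qed.

Let negK f : neg (neg f) = f.
Proof. by apply: functional_extensionality_dep => i; exact: mv_negK. Qed.

Let neg0 : neg c0 = c1.
Proof. by apply: functional_extensionality_dep => i; exact: mv_neg0. Qed.

Let addr1 f : add f c1 = c1.
Proof. by apply: functional_extensionality_dep => i; exact: mv_addr1. Qed.

Let luk f g : add (neg (add (neg f) g)) g = add (neg (add f (neg g))) f.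
Proof. by apply: functional_extensionality_dep => i; exact: mv_luk. Qed.

Definition product_mv : mvAlgebra :=
  MVAlgebra addC addA addN addr0 negK neg0 addr1 luk.

Lemma product_mv_perp (f g : product_mv) :
  mv_perp f g <-> forall i, mv_perp (f i) (g i).
Proof.
split=> [fg i|fg]; first exact: (congr1 (fun h : T => h i) fg).
by apply: functional_extensionality_dep => i; exact: fg.
Qed.

End ProductMV.

(** * Biadditive products with a left unit *)

Section Cloning.
Variables (L : effectAlgebra) (mul : L -> L -> L).
Hypothesis mul_bimorphism : ea_bimorphism mul.
Hypothesis mul1x : forall x, mul ea1 x = x.

(** Splitting [ea1] into [x] and its complement splits [y = mul ea1 y] into [mul x y] and a
    remainder. *)
Lemma mul_le_r x y : ea_le (mul x y) y.
Proof.
have [addl _ _] := mul_bimorphism.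
have [xy e] := addl _ _ y (perp_neg x).
by exists (mul (ea_neg x) y); rewrite -e oplus_neg mul1x.
Qed.

Lemma mul_osum x s : osummable s ->
  osummable [seq mul x y | y <- s]
  /\ osum [seq mul x y | y <- s] = mul x (osum s).
Proof.
have [_ addr _] := mul_bimorphism.
elim: s => [_|y s IHs [/IHs[ss sE] ys]] /=.
  (* Cancellation in [mul x ea0 = oplus (mul x ea0) (mul x ea0)] gives [mul x ea0 = ea0]. *)
  have [h e] := addr x _ _ (perp_ea0 ea0).
  split=> //; rewrite oplus_ea0 in e.
  by apply: (oplus_cancel (perp_ea0 _) h); rewrite oplus_ea0 -e.
have [h e] := addr x _ _ ys.
by rewrite sE.
Qed.

End Cloning.

(** * The embedding into the product of intervals and the extension of states *)

Section HiddenVariables.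
Variables (R : realType) (L : effectAlgebra) (mul : L -> L -> L).
Hypothesis mul_bimorphism : ea_bimorphism mul.
Hypotheses (mulx1 : forall x, mul x ea1 = x) (mul1x : forall x, mul ea1 x = x).
Variables (N : nat) (p : 'I_N -> L).
Hypothesis p_linear : forall n, linearly_ordered (ea_interval0 (p n)).
Hypothesis p_osummable : osummable [seq p n | n <- enum 'I_N].
Hypothesis p_osum : osum [seq p n | n <- enum 'I_N] = ea1.

Lemma mul_hidden_variables : admits_hidden_variables R L.
Proof.
pose E n := intervalAlgebra (p n).
pose M := product_mv (fun n => linear_mv (interval_linear (@p_linear n))).
pose h (x : L) : M :=
  fun n => exist (fun z => ea_le z (p n)) (mul x (p n))
             (mul_le_r mul_bimorphism mul1x x (p n)) : E n.
have perpM (f g : M) : mv_perp f g ->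
    forall n, perp (f n : E n) (g n : E n).
  by move=> /product_mv_perp fg n; have /linear_mv_perp := fg n.
(* On orthogonal elements no truncation occurs, so each coordinate of the sum is computed in [L]. *)
have addM (f g : M) n : mv_perp f g ->
    sval (mv_add f g n : E n) = oplus (sval (f n)) (sval (g n)).
  by move/perpM/(_ n) => fg; rewrite /= trunc_add_perp //= interval_oplusE.
have [addl _ _] := mul_bimorphism.
exists M, h; split; first split.
- move=> x y xy.
  have hxy : mv_perp (h x) (h y).
    apply/product_mv_perp => n; apply/linear_mv_perp.
    (* Orthogonality in the interval also asks that the sum be below [p n]; it is
       [mul (oplus x y) (p n)]. *)
    have [xyn e] := addl _ _ (p n) xy.
    by split=> //=; rewrite -e; exact: mul_le_r.
  split=> //; apply: functional_extensionality_dep => n.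
  apply: interval_inj; rewrite addM //=.
  by have [] := addl _ _ (p n) xy.
- apply: functional_extensionality_dep => n.
  by apply: interval_inj; rewrite /= mul1x.
move=> omega omega_state; have [omega_ge0 omega1 omegaD] := omega_state.
exists (fun f : M => \sum_(n < N) omega (sval (f n : E n)))%R.
split; first split.
- by move=> f; apply: sumr_ge0.
(* The unit of [M] has coordinates [p n], whose orthogonal sum is [ea1]. *)
- rewrite -omega1 -p_osum osum_state // big_map big_enum.
  by apply: eq_bigr.
- move=> f g fg; rewrite -big_split; apply: eq_bigr => n _ /=.
  by rewrite -omegaD -?addM //; have [] := perpM _ _ fg n.
(* Additivity in the second argument decomposes [x = mul x ea1] into the coordinates of [h x]. *)
move=> x; have [xs xE] := mul_osum mul_bimorphism x p_osummable.
rewrite -{2}[x]mulx1 -p_osum -xE osum_state // -map_comp big_map big_enum.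
by apply: eq_bigr.
Qed.

End HiddenVariables.

Theorem theorem3 (R : realType) (L : effectAlgebra) (LL : tensorProduct L L)
  (hclone : cloning_property LL)
  (N : nat) (p : 'I_N -> L)
  (hideal : forall n : 'I_N, ea_ideal (ea_interval0 (p n)))
  (hlin : forall n : 'I_N, linearly_ordered (ea_interval0 (p n)))
  (hdef : osummable [seq p n | n <- enum 'I_N])
  (hsum : osum [seq p n | n <- enum 'I_N] = ea1) :
  admits_hidden_variables R L.
Proof.
have [phi [[phiD phi1] phi_unit]] := hclone.
have [tensorDl tensorDr tensor1] := tensor_bimorphism LL.
(* Composing the bimorphism [tensor] with the morphism [phi] gives a bimorphism; the cloning
   identities make [ea1] its two-sided unit. *)
apply: (@mul_hidden_variables R L (fun x y => phi (tensor LL x y)))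
  hlin hdef hsum.
- split=> [a b q /(tensorDl a b q)|q c d /(tensorDr q c d)|].
  + by case=> /phiD[h e] ->.
  + by case=> /phiD[h e] ->.
  + by rewrite tensor1.
- by move=> x; case: (phi_unit x).
- by move=> x; case: (phi_unit x).
Qed.
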